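(* Let $0<b<\infty$, let $g:[0,b]\to\mathbb{R}$ be continuous and decreasing with $g(x)>0$ for $x\in[0,b)$ (so $g(b)\ge 0$), and let $f:[0,b]\to\mathbb{R}$ be a function such that $\phi(u)=f(g^{-1}(u))$ is a continuous strictly convex function of $u\in[g(b),g(0)]$. (1) If $g(b)=0$ and $f(b)\le 0$, then $f/g$ is decreasing. (2) Suppose that either $g(b)=0$ and $f(b)>0$, or $g(b)>0$. (i) If $\displaystyle \frac{f(0)}{g(0)}-\liminf_{x\to0+}\frac{f(x)-f(0)}{g(x)-g(0)}\ge 0$, then $f/g$ is increasing. (ii) If $g(b)\neq 0$ and $\displaystyle \frac{f(b)}{g(b)}-\liminf_{x\to b-}\frac{f(b)-f(x)}{g(b)-g(x)}\le 0$, then $f/g$ is decreasing. (iii) Otherwise (neither the hypothesis of (i) nor that of (ii) holds), there is a unique $c\in(0,b)$ such that $f/g$ is decreasing to the left of $c$ and increasing to the right of $c$. The corresponding statement holds when $\phi$ is continuous and strictly concave on $[g(b),g(0)]$ instead of strictly convex: (1') If $g(b)=0$ and $f(b)\ge 0$, then $f/g$ is increasing. (2') Suppose that either $g(b)=0$ and $f(b)<0$, or $g(b)>0$. (i') If $\displaystyle \frac{f(0)}{g(0)}-\liminf_{x\to0+}\frac{f(x)-f(0)}{g(x)-g(0)}\le 0$, then $f/g$ is decreasing. (ii') If $g(b)\neq 0$ and $\displaystyle \frac{f(b)}{g(b)}-\liminf_{x\to b-}\frac{f(b)-f(x)}{g(b)-g(x)}\ge 0$, then $f/g$ is increasing. (iii')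 Otherwise, there is a unique $c\in(0,b)$ such that $f/g$ is increasing to the left of $c$ and decreasing to the right of $c$.
   Context: ''Increasing'' and ''decreasing'' mean strictly increasing and strictly decreasing. The quotient $f/g$ is considered on the part of $[0,b]$ where $g\neq0$, i.e. on $[0,b]$ if $g(b)>0$ and on $[0,b)$ if $g(b)=0$. ''To the left of $c$'' and ''to the right of $c$'' refer to the points $x\le c$ and $x\ge c$ of this domain. Since $g$ is continuous and strictly decreasing, $g^{-1}:[g(b),g(0)]\to[0,b]$ is well defined. A liminf is taken in the extended reals $[-\infty,+\infty]$. No differentiability is assumed. A continuous function $\phi$ on an interval is strictly convex if $\phi(\lambda u_1+(1-\lambda)u_2)<\lambda\phi(u_1)+(1-\lambda)\phi(u_2)$ for all $u_1\neq u_2$ and $0<\lambda<1$; strictly concave means the reverse strict inequality. *)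

(* Defs.v *)
From HB Require Import structures.
From mathcomp Require Import all_boot all_order all_algebra.
From mathcomp Require Import all_classical all_reals all_analysis.
Set Implicit Arguments.
Unset Strict Implicit.
Unset Printing Implicit Defensive.
Import Order.TTheory GRing.Theory Num.Theory.
Import numFieldNormedType.Exports.
Local Open Scope classical_set_scope.
Local Open Scope ring_scope.

(* A function on [0, b] is a total function R -> R whose
   values outside [0, b] are never used. *)

Definition increasing_on (R : realType) (A : set R) (h : R -> R) : Prop :=
  {in A &, {homo h : x y / x < y}}.

Definition decreasing_on (R : realType) (A : set R) (h : R -> R) : Prop :=
  {in A &, {homo h : x y /~ x < y}}.

Definition strictly_convex_on (R : realType) (A : set R) (phi : R -> R) : Prop :=
  forall u1 u2 l : R, A u1 -> A u2 -> u1 != u2 -> 0 < l < 1 ->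
    phi (l * u1 + (1 - l) * u2) < l * phi u1 + (1 - l) * phi u2.

Definition strictly_concave_on (R : realType) (A : set R) (phi : R -> R) : Prop :=
  forall u1 u2 l : R, A u1 -> A u2 -> u1 != u2 -> 0 < l < 1 ->
    l * phi u1 + (1 - l) * phi u2 < phi (l * u1 + (1 - l) * u2).

(* u |-> f (g^-1 u), where g^-1 inverts the restriction of g to [0, b];
   the default value 0 is only taken off the image of [0, b] under g. *)
Definition comp_inv (R : realType) (b : R) (f g : R -> R) : R -> R :=
  f \o 'pinv_(fun=> 0) `[0, b]%classic g.

(* [0, b] if g b != 0, and [0, b) if g b = 0, when g > 0 on [0, b). *)
Definition quot_dom (R : realType) (b : R) (g : R -> R) : set R :=
  [set x | 0 <= x <= b /\ g x != 0].

Definition gap_at_0 (R : realType) (f g : R -> R) : \bar R :=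
  ((f 0 / g 0)%:E
   - limf_einf (fun x : R => ((f x - f 0) / (g x - g 0))%:E) 0^'+)%E.

Definition gap_at_b (R : realType) (b : R) (f g : R -> R) : \bar R :=
  ((f b / g b)%:E
   - limf_einf (fun x : R => ((f b - f x) / (g b - g x))%:E) b^'-)%E.

(* Main.v *)
Require Import Defs.
From HB Require Import structures.
From mathcomp Require Import all_boot all_order all_algebra.
From mathcomp Require Import all_classical all_reals all_analysis.
From mathcomp Require Import ring lra.
Import Order.TTheory GRing.Theory Num.Theory.
Import numFieldNormedType.Exports.
Local Open Scope classical_set_scope.
Local Open Scope ring_scope.

(* Strict convexity of phi makes the quotient q = f / g strictly quasi-convex:
   for x < y < z, g y is a convex combination of g x and g z, and f <= m g at x
   and z forces f y < m g y. Hence if q has a minimizer c on its domain, q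
   decreases to the left of c and increases to the right of c. The relative
   slopes of f with respect to g are monotone, so that each liminf is compared
   with K by comparing all the slopes with K, and the slope of f between 0 and x
   lies below q 0 exactly when q 0 <= q x; therefore the sign of the gap at 0
   (resp. b) says whether 0 (resp. b) minimizes q. The remaining case is the
   interior minimizer. The concave case is the convex one for - f. *)

(** * Comparing a liminf along a filter with a constant *)

Section LimInf.
Context {R : realType} (F : set_system R) {FF : ProperFilter F}.

Lemma ge_limf_einf_near (s : R -> R) (k : R) :
  (\forall y \near F, s y <= k) -> (limf_einf (fun y => (s y)%:E) F <= k%:E)%E.
Proof.
move=> sk; rewrite limf_einfE; apply: ge_ereal_sup => _ [V FV <-].
have [y [Vy syk]] := filter_ex (filterI FV sk).
by apply: (@le_trans _ _ (s y)%:E);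
  [apply: ereal_inf_lbound; exists y|rewrite lee_fin].
Qed.

Lemma le_limf_einf_near (s : R -> R) (k : R) :
  (\forall y \near F, k <= s y) -> (k%:E <= limf_einf (fun y => (s y)%:E) F)%E.
Proof.
move=> sk; rewrite limf_einfE; apply: le_ereal_sup_tmp.
eexists; first by exists [set y | k <= s y].
by apply: le_ereal_inf_tmp => _ [y ky <-]; rewrite lee_fin.
Qed.

(** Each [s x] is an eventual lower bound of [s], hence at most the liminf. This fits slopes that
    grow towards the endpoint. *)
Lemma limf_einf_le_lower (A : set R) (s : R -> R) (k : R) : F A ->
  {in A, forall x, \forall y \near F, s x <= s y} ->
  (limf_einf (fun y => (s y)%:E) F <= k%:E)%E <-> {in A, forall x, s x <= k}.
Proof.
move=> FA sA; split=> [lk x Ax|sk].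
  by rewrite -lee_fin (le_trans _ lk)// le_limf_einf_near//; exact: sA.
apply: ge_limf_einf_near; apply: filterS FA => y /mem_set; exact: sk.
Qed.

(** Mirror image, for slopes that fall towards the endpoint: the liminf is at most each [s x]. *)
Lemma limf_einf_ge_upper (A : set R) (s : R -> R) (k : R) : F A ->
  {in A, forall x, \forall y \near F, s y <= s x} ->
  (k%:E <= limf_einf (fun y => (s y)%:E) F)%E <-> {in A, forall x, k <= s x}.
Proof.
move=> FA sA; split=> [lk x Ax|sk].
  by rewrite -lee_fin (le_trans lk)// ge_limf_einf_near//; exact: sA.
apply: le_limf_einf_near; apply: filterS FA => y /mem_set; exact: sk.
Qed.

End LimInf.

(** * Strictly quasi-convex functions around a minimizer *)

Definition quasi_convex_on {R : realType} (A : set R) (h : R -> R) : Prop :=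
  forall x y z, A x -> A y -> A z -> x < y < z -> h y < Num.max (h x) (h z).

Section QuasiConvex.
Context {R : realType} (A : set R) (h : R -> R).
Hypotheses (Aitv : is_interval A) (hA : quasi_convex_on A h).
Variable (c : R).
Hypotheses (Ac : A c) (hc : {in A, forall x, h c <= h x}).

(** Quasi-convexity puts [h x] below the larger of [h c] and [h y]; minimality of [c] rules out
    [h c]. *)
Lemma quasi_convex_between_min (x y : R) :
  A y -> c < x < y \/ y < x < c -> h x < h y.
Proof.
move=> Ay xcy.
have Ax : A x.
  by case: xcy => /andP[? ?]; [apply: (Aitv c y)|apply: (Aitv y c)] => //;
    rewrite !ltW.
have hcx : (h x < h c) = false by apply/negbTE; rewrite -leNgt hc ?inE.
case: xcy => xcy; [have := hA c x y Ac Ax Ay xcy|have := hA y x c Ay Ax Ac xcy];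
  by rewrite lt_max hcx ?orbF.
Qed.

(** The midpoint of [c] and [y] already has a value below [h y], and [h c] is no larger than that
    value. *)
Lemma quasi_convex_strict_min (y : R) : A y -> y != c -> h c < h y.
Proof.
move=> Ay yc; set m := (c + y) / 2.
have my : c < m < y \/ y < m < c.
  by case: (ltgtP y c) yc => // yc _; [right|left]; rewrite /m; lra.
apply: le_lt_trans (quasi_convex_between_min m y Ay my).
apply: hc; rewrite inE.
by case: my => /andP[? ?]; [apply: (Aitv c y)|apply: (Aitv y c)] => //;
  rewrite !ltW.
Qed.

Lemma quasi_convex_increasing : increasing_on (A `&` [set x | c <= x]) h.
Proof.
move=> x y /set_mem[Ax /= cx] /set_mem[Ay /= _] xy.
(* The case [x = c] is separate, as quasi-convexity speaks of three distinct points. *)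
case: (ltgtP c x) cx xy => // [cx|<-] _ xy.
  by apply: quasi_convex_between_min => //; left; rewrite cx.
by apply: quasi_convex_strict_min => //; rewrite gt_eqF.
Qed.

Lemma quasi_convex_decreasing : decreasing_on (A `&` [set x | x <= c]) h.
Proof.
move=> x y /set_mem[Ax /= xc] /set_mem[Ay /= yc] yx.
case: (ltgtP c x) xc yx => // [xc|<-] _ yx.
  by apply: quasi_convex_between_min => //; right; rewrite yx.
by apply: quasi_convex_strict_min => //; rewrite lt_eqF.
Qed.

End QuasiConvex.

(** * Monotonicity under restriction and negation *)

Section IncreasingDecreasing.
Context {R : realType}.
Implicit Types (A B : set R) (h : R -> R).

Lemma increasing_onS A B h : A `<=` B -> increasing_on B h -> increasing_on A h.
Proof.
by move=> AB hB x y /set_mem/AB/mem_set xB /set_mem/AB/mem_set; exact: hB.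
Qed.

Lemma decreasing_onS A B h : A `<=` B -> decreasing_on B h -> decreasing_on A h.
Proof.
by move=> AB hB x y /set_mem/AB/mem_set xB /set_mem/AB/mem_set; exact: hB.
Qed.

Lemma increasing_onN A h : increasing_on A (- h) <-> decreasing_on A h.
Proof. by split=> hA x y xA yA yx; have := hA y x yA xA yx; rewrite ltrN2. Qed.

Lemma decreasing_onN A h : decreasing_on A (- h) <-> increasing_on A h.
Proof. by split=> hA x y xA yA yx; have := hA y x yA xA yx; rewrite ltrN2. Qed.

End IncreasingDecreasing.

(** Strict convexity of [f] as a function of [g], with the denominator [g x - g z] cleared and no
    inverse of [g]. *)
Definition convex_wrt {R : realType} (b : R) (g f : R -> R) : Prop :=
  forall x y z, 0 <= x -> x < y < z -> z <= b ->
    (g x - g z) * f y < (g y - g z) * f x + (g x - g y) * f z.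

Definition slope {R : realType} (g f : R -> R) (x y : R) : R :=
  (f y - f x) / (g y - g x).

(** * Slopes relative to [g], and the quotient [f / g] *)

Section Quotient.
Context {R : realType} (b : R) (g : R -> R).
Hypotheses (b_gt0 : 0 < b) (g_decr : decreasing_on `[0, b] g)
  (g_gt0 : forall x : R, 0 <= x < b -> 0 < g x) (gb_ge0 : 0 <= g b).
Implicit Type f : R -> R.

Let D := quot_dom b g.

Let gP (x y : R) : 0 <= x -> x < y -> y <= b -> g y < g x.
Proof.
by move=> x0 xy yb; apply: g_decr => //; rewrite inE /= in_itv /=; lra.
Qed.

Let D_le (x : R) : D x -> 0 <= x /\ x <= b. Proof. by case=> /andP. Qed.

Let D_gt0 (x : R) : D x -> 0 < g x.
Proof.
move=> [/andP[x0 xb] gx]; case: (ltgtP x b) xb => // [xb _|xb _].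
  by apply: g_gt0; rewrite x0.
by rewrite lt0r gx xb.
Qed.

Let lt_D (x : R) : 0 <= x < b -> D x.
Proof.
move=> xb; split; last by rewrite gt_eqF// g_gt0.
by case/andP: xb => -> /ltW.
Qed.

Let D0 : D 0. Proof. by apply: lt_D; rewrite lexx. Qed.

Let D_itv : is_interval D.
Proof.
move=> x y [/andP[x0 xb] gx] Dy z /andP[xz zy]; have [/andP[y0 yb] gy] := Dy.
case: (ltgtP z y) zy => // [zy _|->//].
by apply: lt_D; rewrite (le_trans x0)//= (lt_le_trans zy).
Qed.

(** Chord slopes of a convex function grow with the free end; since [g] decreases, moving that end
    from [y] to [z] lowers the slope. *)
Lemma slope_le_left f (x y z : R) : convex_wrt b g f ->
  0 <= x -> x < y < z -> z <= b -> slope g f x z <= slope g f x y.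
Proof.
move=> cf x0 xyz zb; have := cf x y z x0 xyz zb; case/andP: xyz => xy yz.
have gxy : g y < g x by apply: gP => //; lra.
have gyz : g z < g y by apply: gP => //; lra.
(* The denominators are negative; both signs are flipped before cross-multiplying. *)
move=> h; rewrite /slope -[leLHS]divrNN -[leRHS]divrNN !opprB.
rewrite ler_pdivrMr ?subr_gt0 ?(lt_trans gyz)// mulrAC ler_pdivlMr ?subr_gt0//.
by nra.
Qed.

Lemma slope_le_right f (x y z : R) : convex_wrt b g f ->
  0 <= x -> x < y < z -> z <= b -> slope g f y z <= slope g f x z.
Proof.
move=> cf x0 xyz zb; have := cf x y z x0 xyz zb; case/andP: xyz => xy yz.
have gxy : g y < g x by apply: gP => //; lra.
have gyz : g z < g y by apply: gP => //; lra.
move=> h; rewrite /slope -[leLHS]divrNN -[leRHS]divrNN !opprB.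
rewrite ler_pdivrMr ?subr_gt0// mulrAC ler_pdivlMr ?subr_gt0 ?(lt_trans gyz)//.
by nra.
Qed.

Lemma slopeN f (x y : R) : slope g (- f) x y = - slope g f x y.
Proof. by rewrite /slope -mulNr opprB opprK addrC. Qed.

(** The two differences agree up to the positive factor [g y / (g x - g y)]. *)
Lemma slope_le_quot f (x y : R) : D x -> D y -> x < y ->
  (slope g f x y <= f x / g x) = (f x / g x <= f y / g y).
Proof.
move=> Dx Dy xy.
have [[x0 _] [_ yb]] := (D_le x Dx, D_le y Dy).
have [[gx gy] gyx] := (D_gt0 x Dx, D_gt0 y Dy, gP x y x0 xy yb).
rewrite -subr_ge0 -[RHS]subr_ge0.
have -> : f x / g x - slope g f x y =
    (f y / g y - f x / g x) * (g y / (g x - g y)).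
  rewrite /slope; field; rewrite subr_eq0 (gt_eqF gyx) subr_eq0 (lt_eqF gyx).
  by rewrite !gt_eqF.
by rewrite pmulr_lge0// divr_gt0 ?subr_gt0.
Qed.

Lemma quot_le_slope f (x y : R) : D x -> D y -> x < y ->
  (f y / g y <= slope g f x y) = (f y / g y <= f x / g x).
Proof.
move=> Dx Dy xy.
have [[x0 _] [_ yb]] := (D_le x Dx, D_le y Dy).
have [[gx gy] gyx] := (D_gt0 x Dx, D_gt0 y Dy, gP x y x0 xy yb).
rewrite -subr_ge0 -[RHS]subr_ge0.
have -> : slope g f x y - f y / g y =
    (f x / g x - f y / g y) * (g x / (g x - g y)).
  rewrite /slope; field; rewrite subr_eq0 (gt_eqF gyx) subr_eq0 (lt_eqF gyx).
  by rewrite !gt_eqF.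
by rewrite pmulr_lge0// divr_gt0 ?subr_gt0.
Qed.

Lemma quot_quasi_convex f : convex_wrt b g f ->
  quasi_convex_on D (fun x => f x / g x).
Proof.
move=> cf x y z Dx Dy Dz xyz; set m := Num.max _ _.
have [[gx gy] gz] := (D_gt0 x Dx, D_gt0 y Dy, D_gt0 z Dz).
have [[x0 _] [_ zb]] := (D_le x Dx, D_le z Dz).
have fx : f x <= m * g x by rewrite -ler_pdivrMr// le_max lexx.
have fz : f z <= m * g z by rewrite -ler_pdivrMr// le_max lexx orbT.
have h := cf x y z x0 xyz zb; case/andP: xyz => xy yz.
have gxy : g y < g x by apply: gP => //; lra.
have gyz : g z < g y by apply: gP => //; lra.
(* The weights of [convex_wrt] average [g x] and [g z] to [(g x - g z) * g y], so [fx] and [fz] give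
   the bound. *)
rewrite ltr_pdivrMr// -(ltr_pM2l (_ : 0 < g x - g z)); last lra.
by apply: lt_le_trans h _; nra.
Qed.

Let near0_D : \forall x \near 0^'+, (D `\ 0) x.
Proof.
apply: filterS2 (nbhs_right_gt 0) (nbhs_right_lt b_gt0) => x x0 xb.
by split; [apply: lt_D; rewrite xb ltW|apply/eqP; rewrite gt_eqF].
Qed.

Let nearb_D : \forall x \near b^'-, (D `\ b) x.
Proof.
apply: filterS2 (nbhs_left_lt b) (nbhs_left_gt b_gt0) => x xb x0.
by split; [apply: lt_D; rewrite xb ltW|apply/eqP; rewrite lt_eqF].
Qed.

Let D_neq0 (x : R) : x \in D `\ 0 -> D x /\ 0 < x.
Proof.
move=> /set_mem[Dx /eqP x0]; split => //.
by rewrite lt0r x0 (D_le x Dx).1.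
Qed.

Let D_neqb (x : R) : x \in D `\ b -> D x /\ x < b.
Proof.
move=> /set_mem[Dx /eqP xb]; split => //.
by rewrite lt_neqAle xb (D_le x Dx).2.
Qed.

(** Slopes based at [c] carry information only away from [c], while the quotient inequality at [c]
    is trivial. *)
Let forall_D_neq (P : R -> Prop) (c : R) : P c ->
  {in D `\ c, forall x, P x} <-> {in D, forall x, P x}.
Proof.
move=> Pc; split=> h x /set_mem Dx; last by apply: h; rewrite inE; case: Dx.
by have [->//|/eqP xc] := eqVneq x c; apply: h; rewrite inE.
Qed.

Lemma gap_at_0_ge0 f : convex_wrt b g f ->
  (0 <= gap_at_0 f g)%E <-> {in D, forall x, f 0 / g 0 <= f x / g x}.
Proof.
(* The quotient at 0 is finite, so the sign of the gap is a comparison even if the liminf is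
   infinite. *)
move=> cf; rewrite sube_ge0 ?orbT//.
rewrite -(forall_D_neq (fun x => f 0 / g 0 <= f x / g x) 0)//.
rewrite (limf_einf_le_lower 0^'+ (D `\ 0) (slope g f 0))//; last first.
  move=> x /D_neq0[Dx x0]; have := nbhs_right_lt x0.
  apply: filterS2 (nbhs_right_gt 0) => y y0 yx.
  by apply: slope_le_left (D_le x Dx).2 => //; rewrite y0.
by split=> h x xD; have [Dx x0] := D_neq0 x xD; have := h x xD;
  rewrite slope_le_quot.
Qed.

(** Negating [f] would turn the liminf into a limsup, so this does not follow from the convex case.
    Only the individual slopes are negated; those of [f] now fall towards 0. *)
Lemma gap_at_0_le0 f : convex_wrt b g (- f) ->
  (gap_at_0 f g <= 0)%E <-> {in D, forall x, f x / g x <= f 0 / g 0}.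
Proof.
move=> cf; rewrite sube_le0 ?orbT//.
rewrite -(forall_D_neq (fun x => f x / g x <= f 0 / g 0) 0)//.
rewrite (limf_einf_ge_upper 0^'+ (D `\ 0) (slope g f 0))//; last first.
  move=> x /D_neq0[Dx x0]; have := nbhs_right_lt x0.
  apply: filterS2 (nbhs_right_gt 0) => y y0 yx; rewrite -lerN2 -!slopeN.
  by apply: slope_le_left (D_le x Dx).2 => //; rewrite y0.
split=> h x xD; have [Dx x0] := D_neq0 x xD; have := h x xD.
  by rewrite -lerN2 -slopeN -mulNr slope_le_quot// !mulNr lerN2.
by rewrite -[_ <= slope _ _ _ _]lerN2 -slopeN -mulNr slope_le_quot//
  !mulNr lerN2.
Qed.

(** Slopes ending at [b] fall towards [b], so the liminf is at least the quotient at [b] exactly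
    when every slope is. *)
Lemma gap_at_b_le0 f : D b -> convex_wrt b g f ->
  (gap_at_b b f g <= 0)%E <-> {in D, forall x, f b / g b <= f x / g x}.
Proof.
move=> Db cf; rewrite sube_le0 ?orbT//.
rewrite -(forall_D_neq (fun x => f b / g b <= f x / g x) b)//.
rewrite (limf_einf_ge_upper b^'- (D `\ b) (slope g f ^~ b))//; last first.
  move=> x /D_neqb[Dx xb]; have := nbhs_left_gt xb.
  apply: filterS2 (nbhs_left_lt b) => y yb xy.
  by apply: slope_le_right (D_le x Dx).1 _ _ => //; rewrite xy.
by split=> h x xD; have [Dx xb] := D_neqb x xD; have := h x xD;
  rewrite quot_le_slope.
Qed.

Lemma gap_at_b_ge0 f : D b -> convex_wrt b g (- f) ->
  (0 <= gap_at_b b f g)%E <-> {in D, forall x, f x / g x <= f b / g b}.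
Proof.
move=> Db cf; rewrite sube_ge0 ?orbT//.
rewrite -(forall_D_neq (fun x => f x / g x <= f b / g b) b)//.
rewrite (limf_einf_le_lower b^'- (D `\ b) (slope g f ^~ b))//; last first.
  move=> x /D_neqb[Dx xb]; have := nbhs_left_gt xb.
  apply: filterS2 (nbhs_left_lt b) => y yb xy; rewrite -lerN2 -!slopeN.
  by apply: slope_le_right (D_le x Dx).1 _ _ => //; rewrite xy.
split=> h x xD; have [Dx xb] := D_neqb x xD; have := h x xD.
  by rewrite -lerN2 -slopeN -mulNr (quot_le_slope (- f))// !mulNr lerN2.
by rewrite -[slope _ _ _ _ <= _]lerN2 -slopeN -mulNr
  (quot_le_slope (- f))// !mulNr lerN2.
Qed.

(** The interval stops at a point of [D], since [g] may vanish at [b]. *)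
Lemma quot_within_continuous f (z : R) : D z ->
  {within `[0, b], continuous g} -> {within `[0, b], continuous f} ->
  {within `[0, z], continuous (fun x => f x / g x)}.
Proof.
move=> Dz cg cf.
have zb : `[0, z] `<=` `[0, b].
  by apply: subset_itvl; rewrite bnd_simp (D_le z Dz).2.
have /subspace_continuousP {}cg := continuous_subspaceW zb cg.
have /subspace_continuousP {}cf := continuous_subspaceW zb cf.
apply/subspace_continuousP => x xz; apply: cvgM; first exact: cf.
apply: cvgV; last exact: cg.
move: xz; rewrite /= in_itv /= => xz.
by rewrite gt_eqF// D_gt0//; apply: (D_itv 0 z).
Qed.

(** If [g b = 0] the domain is not compact, but near [b] the quotient exceeds its value at 0, so
    minimizing over a compact [[0, z]] suffices. *)
Lemma quot_has_min f :
  {within `[0, b], continuous g} -> {within `[0, b], continuous f} ->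
  0 < f b \/ 0 < g b ->
  exists2 c, D c & {in D, forall x, f c / g c <= f x / g x}.
Proof.
move=> cg cf pos.
have [z Dz hz] : exists2 z, D z &
    {in D, forall x, z < x -> f 0 / g 0 <= f x / g x}.
  have [gb0|gb] := eqVneq (g b) 0; last first.
    have Db : D b by split; rewrite ?gb// lexx ltW.
    by exists b => // x /set_mem/D_le[_ xb] bx; lra.
  have fb : 0 < f b by case: pos => //; rewrite gb0 ltxx.
  have [_ _ cgb] := (continuous_within_itvP g b_gt0).1 cg.
  have [_ _ cfb] := (continuous_within_itvP f b_gt0).1 cf.
  (* The comparison with the quotient at 0 is cross-multiplied to avoid dividing by [g x], which
     tends to 0; the limit [f b * g 0] is positive. *)
  have : (f x * g 0 - f 0 * g x) @[x --> b^'-] --> f b * g 0 - f 0 * g b.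
    by apply: cvgB; apply: cvgM => //; exact: cvg_cst.
  rewrite gb0 mulr0 subr0 => /cvgr_gt/(_ 0).
  rewrite pmulr_rgt0// D_gt0// => /(_ isT)/nbhs_ballP[e /= e0 be].
  (* Points between this [z] and [b] lie within [e] of [b]; the maximum keeps [z] nonnegative. *)
  exists (Num.max 0 (b - e / 2)).
    by apply: lt_D; rewrite le_max lexx/= gt_max b_gt0 ltrBlDr ltrDl divr_gt0.
  move=> x /set_mem Dx; rewrite gt_max => /andP[x0 bx].
  have xb : x < b.
    rewrite lt_neqAle (D_le x Dx).2 andbT; apply/eqP => xb.
    by case: Dx; rewrite xb gb0 eqxx.
  rewrite ler_pdivrMr ?D_gt0// mulrAC ler_pdivlMr ?D_gt0// -subr_ge0 ltW//.
  by apply: be => //; rewrite /ball /= ger0_norm; lra.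
have [z0 zb] := D_le z Dz.
have [c] := EVT_min z0 (quot_within_continuous f z Dz cg cf).
rewrite in_itv /= => /andP[c0 cz] hc.
exists c; first by apply: (D_itv 0 z) => //; rewrite c0.
move=> x /[dup] xD /set_mem Dx; have [xz|zx] := leP x z.
  by apply: hc; rewrite in_itv /= xz (D_le x Dx).1.
by apply: le_trans (hz x xD zx); apply: hc; rewrite in_itv /= lexx.
Qed.

(** Gap conditions are replaced by minimality at 0 and at [b], which, unlike the gaps, behave well
    under negation; so the concave case can use it for [- f]. *)
Lemma convex_quotient f :
  {within `[0, b], continuous g} -> {within `[0, b], continuous f} ->
  convex_wrt b g f ->
  let q := fun x => f x / g x in
  (g b = 0 -> f b <= 0 -> decreasing_on D q) /\
  ((g b = 0 /\ 0 < f b) \/ 0 < g b ->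
    [/\ {in D, forall x, q 0 <= q x} -> increasing_on D q,
        g b != 0 /\ {in D, forall x, q b <= q x} -> decreasing_on D q &
        ~ {in D, forall x, q 0 <= q x} ->
        ~ (g b != 0 /\ {in D, forall x, q b <= q x}) ->
        exists! c : R, [/\ 0 < c < b,
          decreasing_on (D `&` [set x | x <= c]) q &
          increasing_on (D `&` [set x | c <= x]) q]]).
Proof.
move=> cg cf convf q; have qq := quot_quasi_convex f convf.
split=> [gb0 fb0 y x /set_mem Dy /set_mem Dx xy|pos].
  have [x0 _] := D_le x Dx.
  have yb : y < b.
    rewrite lt_neqAle (D_le y Dy).2 andbT; apply/eqP => yb.
    by case: Dy; rewrite yb gb0 eqxx.
  (* Convexity with third point [b]: as [g b = 0], what remains beyond the wanted inequality is
     [(g x - g y) * f b], which is at most 0. *)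
  have := convf x y b x0; rewrite xy yb gb0 !subr0 => /(_ isT (lexx _)) h.
  have gyx := gP x y x0 xy (ltW yb).
  rewrite /q ltr_pdivrMr ?D_gt0// mulrAC ltr_pdivlMr ?D_gt0// mulrC.
  apply: lt_le_trans h _; rewrite mulrC gerDl.
  by rewrite pmulr_rle0// subr_gt0.
have inc0 : {in D, forall x, q 0 <= q x} -> increasing_on D q.
  move=> h; apply: increasing_onS (quasi_convex_increasing D q D_itv qq 0 D0 h).
  by move=> x Dx; split => //=; case: (D_le x Dx).
have decb : g b != 0 /\ {in D, forall x, q b <= q x} -> decreasing_on D q.
  move=> [gb h].
  have Db : D b by split; rewrite ?gb// lexx ltW.
  apply: decreasing_onS (quasi_convex_decreasing D q D_itv qq b Db h).
  by move=> x Dx; split => //=; case: (D_le x Dx).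
split=> // n0 nb.
have [c Dc hc] : exists2 c, D c & {in D, forall x, q c <= q x}.
  by apply: quot_has_min => //; case: pos => [[]|]; [left|right].
have [c0 cb] := D_le c Dc.
(* A minimizer at 0 or at [b] would fall under one of the two excluded cases. *)
have {}c0 : 0 < c.
  by rewrite lt0r c0 andbT; apply/eqP => c0'; apply: n0; rewrite -c0'.
have {}cb : c < b.
  rewrite lt_neqAle cb andbT; apply/eqP => cb'; apply: nb; rewrite -cb'.
  split=> //.
  by rewrite gt_eqF ?D_gt0.
exists c; split.
  split; first by rewrite c0.
    exact: quasi_convex_decreasing.
  exact: quasi_convex_increasing.
(* Uniqueness: between two distinct turning points [q] would both increase and decrease. *)
have no_overlap u v : 0 < u -> v < b -> u < v ->
    increasing_on (D `&` [set x | u <= x]) q ->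
    decreasing_on (D `&` [set x | x <= v]) q -> False.
  move=> u0 vb uv iu dv.
  have [Du Dv] : D u /\ D v by split; apply: lt_D; apply/andP; split; lra.
  have : q u < q v by apply: iu => //; rewrite inE; split => //=; lra.
  have : q v < q u by apply: dv => //; rewrite inE; split => //=; lra.
  by move=> /lt_trans/[apply]; rewrite ltxx.
move=> c' [/andP[c'0 c'b] dc' ic'].
case: (ltgtP c c') => // cc'; exfalso.
  by apply: (no_overlap c c') => //; exact: quasi_convex_increasing.
by apply: (no_overlap c' c) => //; exact: quasi_convex_decreasing.
Qed.

End Quotient.

(** * Passing from [phi] to [f] and [g] *)

Section CompInv.
Context {R : realType} (b : R) (g f : R -> R).
Hypotheses (g_cont : {within `[0, b], continuous g})
  (g_decr : decreasing_on `[0, b] g).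

Lemma decreasing_on_image (x : R) : 0 <= x <= b -> `[g b, g 0]%classic (g x).
Proof.
move=> /andP[x0 xb]; rewrite /= in_itv /=; apply/andP; split.
  move: xb; rewrite (le_eqVlt x) => /orP[/eqP->//|xb]; apply/ltW/g_decr => //;
    by rewrite inE /= in_itv /=; lra.
move: x0; rewrite (le_eqVlt 0) => /orP[/eqP<-//|x0]; apply/ltW/g_decr => //;
  by rewrite inE /= in_itv /=; lra.
Qed.

Lemma comp_invE (x : R) : 0 <= x <= b -> comp_inv b f g (g x) = f x.
Proof.
move=> xb; rewrite /comp_inv /= pinvKV//; last by rewrite inE /= in_itv.
move=> y z yb zb gyz; case: (ltgtP y z) => // yz; exfalso.
  by have := g_decr z y zb yb yz; rewrite gyz ltxx.
by have := g_decr y z yb zb yz; rewrite gyz ltxx.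
Qed.

Lemma comp_inv_continuous :
  {within `[g b, g 0], continuous (comp_inv b f g)} ->
  {within `[0, b], continuous f}.
Proof.
move=> /subspace_continuousP cphi; apply/subspace_continuousP => x xb.
have xb' : 0 <= x <= b by move: xb; rewrite /= in_itv.
(* [phi] is continuous only relative to [[g b, g 0]], so [g] must be shown to converge within that
   interval. *)
have cgx : g y @[y --> within `[0, b]%classic (nbhs x)] -->
    within `[g b, g 0]%classic (nbhs (g x)).
  move=> V /= gV.
  have /subspace_continuousP/(_ x xb)/(_ _ gV) := g_cont.
  apply: (@filterS _ (nbhs x) _ [set y | `[0, b]%classic y ->
    `[g b, g 0]%classic (g y) -> V (g y)]) => y h yb; apply: h => //.
  by apply: decreasing_on_image; move: yb; rewrite /= in_itv.
have : comp_inv b f g (g y) @[y --> within `[0, b]%classic (nbhs x)] --> f x.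
  rewrite -(comp_invE x)//.
  exact: cvg_comp _ _ cgx (cphi _ (decreasing_on_image x xb')).
apply: cvg_trans; apply: near_eq_cvg.
apply: (@filterS _ (nbhs x) _ setT); last exact: filterT.
by move=> y _ yb /=; rewrite comp_invE//; move: yb; rewrite /= in_itv.
Qed.

Lemma comp_inv_convex_wrt : strictly_convex_on `[g b, g 0] (comp_inv b f g) ->
  convex_wrt b g f.
Proof.
move=> cphi x y z x0 /andP[xy yz] zb.
have [xb yb zb'] : [/\ 0 <= x <= b, 0 <= y <= b & 0 <= z <= b] by split; lra.
have gyx : g y < g x by apply: g_decr => //; rewrite inE /= in_itv.
have gzy : g z < g y by apply: g_decr => //; rewrite inE /= in_itv.
have gzx := lt_trans gzy gyx.
have gxz : g x - g z != 0 by rewrite subr_eq0 gt_eqF.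
(* The weight for which [l * g x + (1 - l) * g z] equals [g y]. *)
pose l := (g y - g z) / (g x - g z).
have := cphi (g x) (g z) l (decreasing_on_image x xb)
  (decreasing_on_image z zb').
rewrite gt_eqF// => /(_ isT).
have -> : l * g x + (1 - l) * g z = g y by rewrite /l; field.
have -> : 0 < l < 1.
  by rewrite divr_gt0 ?subr_gt0//= ltr_pdivrMr ?subr_gt0// mul1r ltrD2r.
move=> /(_ isT); rewrite !comp_invE//.
rewrite -(ltr_pM2l (_ : 0 < g x - g z)) ?subr_gt0//.
move=> /lt_le_trans; apply; rewrite le_eqVlt; apply/orP; left; apply/eqP.
by rewrite /l; field.
Qed.

End CompInv.

(** In [comp_inv] the function [f] is applied last, so negating [f] negates [phi]. *)
Lemma comp_inv_concave_wrt (R : realType) (b : R) (g f : R -> R) :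
  decreasing_on `[0, b] g ->
  strictly_concave_on `[g b, g 0] (comp_inv b f g) -> convex_wrt b g (- f).
Proof.
move=> g_decr cphi; apply: comp_inv_convex_wrt => // u v l Iu Iv uv l01.
have := cphi u v l Iu Iv uv l01; rewrite -ltrN2 opprD -!mulrN; exact.
Qed.

(** * Monotonicity of the quotient in the convex and concave cases *)

Theorem theorem2 (R : realType) (b : R) (g f : R -> R)
    (b_gt0 : 0 < b)
    (g_cont : {within `[0, b], continuous g})
    (g_decr : decreasing_on `[0, b] g)
    (g_gt0 : forall x : R, 0 <= x < b -> 0 < g x) :
  let phi := comp_inv b f g in
  let I := `[g b, g 0]%classic in
  let D := quot_dom b g in
  let q := fun x : R => f x / g x in
  ({within I, continuous phi} -> strictly_convex_on I phi ->
    (g b = 0 -> f b <= 0 -> decreasing_on D q) /\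
    ((g b = 0 /\ 0 < f b) \/ 0 < g b ->
      [/\ (0 <= gap_at_0 f g)%E -> increasing_on D q,
          g b != 0 /\ (gap_at_b b f g <= 0)%E -> decreasing_on D q &
          ~ (0 <= gap_at_0 f g)%E ->
          ~ (g b != 0 /\ (gap_at_b b f g <= 0)%E) ->
          exists! c : R, [/\ 0 < c < b,
            decreasing_on (D `&` [set x | x <= c]) q &
            increasing_on (D `&` [set x | c <= x]) q] ]))
  /\
  ({within I, continuous phi} -> strictly_concave_on I phi ->
    (g b = 0 -> 0 <= f b -> increasing_on D q) /\
    ((g b = 0 /\ f b < 0) \/ 0 < g b ->
      [/\ (gap_at_0 f g <= 0)%E -> decreasing_on D q,
          g b != 0 /\ (0 <= gap_at_b b f g)%E -> increasing_on D q &
          ~ (gap_at_0 f g <= 0)%E ->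
          ~ (g b != 0 /\ (0 <= gap_at_b b f g)%E) ->
          exists! c : R, [/\ 0 < c < b,
            increasing_on (D `&` [set x | x <= c]) q &
            decreasing_on (D `&` [set x | c <= x]) q] ])).
Proof.
move=> phi I D q; split=> cphi convphi.
  have cf : {within `[0, b], continuous f}.
    exact: comp_inv_continuous b g f g_cont g_decr cphi.
  have convf : convex_wrt b g f by exact: comp_inv_convex_wrt convphi.
  split=> [gb0|pos].
    have gb : 0 <= g b by rewrite gb0.
    exact: (convex_quotient b g _ _ _ gb f g_cont cf convf).1.
  have gb : 0 <= g b by case: pos => [[->]|/ltW].
  have [] := (convex_quotient b g b_gt0 g_decr g_gt0 gb f g_cont
    cf convf).2 pos.
  have /propext gap0 := gap_at_0_ge0 b g b_gt0 g_decr g_gt0 gb f convf.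
  (* The conjunct [g b != 0] stays on both sides because it supplies [D b], needed for the
     equivalence. *)
  have /propext gapb : g b != 0 /\ (gap_at_b b f g <= 0)%E <->
      g b != 0 /\ {in D, forall x, q b <= q x}.
    split=> -[gbn0 h]; split=> //; move: h;
      by apply gap_at_b_le0 => //; split; rewrite // lexx ltW.
  by rewrite gap0 gapb.
have cf : {within `[0, b], continuous f}.
  exact: comp_inv_continuous b g f g_cont g_decr cphi.
have convf : convex_wrt b g (- f) by exact: comp_inv_concave_wrt convphi.
have cNf : {within `[0, b], continuous (- f)}.
  by move=> x; apply: cvgN; exact: cf.
have qN : (fun x => (- f) x / g x) = - q.
  by apply/funext => x; rewrite /q mulNr.
split=> [gb0 fb|pos].
  have gb : 0 <= g b by rewrite gb0.
  apply/decreasing_onN; rewrite -qN.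
  apply: (convex_quotient b g b_gt0 g_decr g_gt0 gb (- f) g_cont
    cNf convf).1 => //.
  by rewrite oppr_le0.
have gb : 0 <= g b by case: pos => [[->]|/ltW].
have posN : (g b = 0 /\ 0 < (- f) b) \/ 0 < g b.
  by case: pos => [[gb0 fb]|]; [left; rewrite oppr_gt0|right].
have := (convex_quotient b g b_gt0 g_decr g_gt0 gb (- f) g_cont
  cNf convf).2 posN.
rewrite /= qN.
(* [convex_quotient] for [- f] speaks of minimizers of [- q], the concave gap lemmas of maximizers
   of [q]. *)
have minN c : {in D, forall x, (- f) c / g c <= (- f) x / g x} <->
    {in D, forall x, q x <= q c}.
  by split=> h x /h; rewrite !mulNr lerN2.
have /propext gap0 := gap_at_0_le0 b g b_gt0 g_decr g_gt0 gb f convf.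
have /propext gapb : g b != 0 /\ (0 <= gap_at_b b f g)%E <->
    g b != 0 /\ {in D, forall x, q x <= q b}.
  split=> -[gbn0 h]; split=> //; move: h;
    by apply gap_at_b_ge0 => //; split; rewrite // lexx ltW.
move=> [inc0 decb ex]; rewrite gap0 gapb; split.
- by move=> /(minN 0).2 h; apply/increasing_onN/inc0.
- by move=> [gbn0 /(minN b).2 h]; apply/decreasing_onN/decb.
move=> n0 nb; have [||c [[c0b dc ic] uc]] := ex.
- by move/(minN 0).1.
- by move=> [gbn0 /(minN b).1 h]; apply: nb.
exists c; split; first by split=> //;
  [apply/decreasing_onN|apply/increasing_onN].
move=> c' [c'0b ic' dc']; apply: uc.
by split=> //; [apply/decreasing_onN|apply/increasing_onN].
Qed.
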